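(* Let $\rho\in(0,0.5)$ and $\nu\in(0,0.5)$ be such that $2\nu^2\le\rho\le\nu$. Let $$S_{\rho,\nu}:=\{(p,q): k\in\mathbb N,\ p\in\Delta_k,\ q\in\Delta_k,\ d_{\mathrm{TV}}(p,q)=\nu,\ d_{\mathrm h}^2(p,q)=\rho\}.$$ For $\epsilon>0$, let $n^*(S_{\rho,\nu},\epsilon)$ be the minimax-optimal sample complexity of hypothesis testing under $\epsilon$-LDP constraints, defined as $$n^*(S_{\rho,\nu},\epsilon)=\min_{(\phi,\mathcal R)}\ \max_{(p,q)\in S_{\rho,\nu}} n^*(p,q,\epsilon),$$ over test-rule pairs $(\phi,\mathcal R)$. Then $$n^*(S_{\rho,\nu},\epsilon)=\begin{cases}\widetilde\Theta\left(\dfrac{1}{\epsilon^2\nu^2}\right), & \text{if }\epsilon\le 1,\\[2mm] \widetilde\Theta\left(\min\left(\dfrac1{\nu^2},\dfrac{1}{e^\epsilon\rho^2}\right)\right), & \text{if } e^\epsilon\in\left[e,\dfrac1\rho\right],\\[2mm] \widetilde\Theta\left(\dfrac1\rho\right), & \text{if } e^\epsilon>\dfrac1\rho,\end{cases}$$ where $\widetilde\Theta$ hides poly-logarithmic factors in $1/\nu$ and $1/\rho$.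
   Context: $\Delta_k$ is the set of probability distributions on $[k]=\{1,\dots,k\}$. $d_{\mathrm{TV}}(p,q)=\frac12\sum_i|p_i-q_i|$ and $d_{\mathrm h}^2(p,q)=\sum_i(\sqrt{p_i}-\sqrt{q_i})^2$. A channel $\mathbf T$ from $\mathcal X$ to a countable set $\mathcal Y$ is a transition kernel $\mathbf T(y,x)=\mathbb P(Y=y\mid X=x)$, also viewed as a stochastic map $Y=\mathbf T(X)$. It is $\epsilon$-LDP if $\mathbf T(y,x)\le e^\epsilon\,\mathbf T(y,x')$ for all $x,x'\in\mathcal X$, $y\in\mathcal Y$. A test-rule pair $(\phi,\mathcal R)$ consists of a deterministic rule $\mathcal R$ assigning to each user $i\in[n]$ an $\epsilon$-LDP channel $\mathbf T_i$ from $\mathcal X$ to $\mathbb N$, and a test $\phi:\bigcup_{j\ge1}\mathbb N^j\to\{p,q\}$. It solves the testing problem for $(p,q)$ with sample complexity $n$ if, when $X_1,\dots,X_n$ are i.i.d. and $Y_i=\mathbf T_i(X_i)$ are generated independently, $$\mathbb P_{(X_1,\dots,X_n)\sim p^{\otimes n}}(\phi(Y_1,\dots,Y_n)\ne p)+\mathbb P_{(X_1,\dots,X_n)\sim q^{\otimes n}}(\phi(Y_1,\dots,Y_n)\ne q)\le 0.1.$$ $n^*(p,q,\epsilon)$ is the smallest $n$ for which some test-rule pair solves the problem for $(p,q)$ with sample complexity $n$. *)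

(* Defs.v *)
From HB Require Import structures.
From mathcomp Require Import all_boot all_order all_algebra.
From mathcomp Require Import all_classical all_reals all_analysis.

Set Implicit Arguments.
Unset Strict Implicit.
Unset Printing Implicit Defensive.

Import Order.TTheory GRing.Theory Num.Theory.

Local Open Scope classical_set_scope.
Local Open Scope ring_scope.

Section Distributions.
Context {R : realType}.

Definition simplex (k : nat) : set {ffun 'I_k -> R} :=
  [set p | (forall i, 0 <= p i) /\ \sum_i p i = 1].

Definition dTV (k : nat) (p q : {ffun 'I_k -> R}) : R :=
  2^-1 * \sum_i `|p i - q i|.

Definition dhel2 (k : nat) (p q : {ffun 'I_k -> R}) : R :=
  \sum_i (Num.sqrt (p i) - Num.sqrt (q i)) ^+ 2.

(* [T y x] is the probability of the output [y] on the input [x]. *)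
Definition channel (k : nat) (T : nat -> 'I_k -> R) : Prop :=
  (forall x y, 0 <= T y x) /\
  (forall x, \esum_(y in [set: nat]) (T y x)%:E = 1%E).

Definition LDP (eps : R) (k : nat) (T : nat -> 'I_k -> R) : Prop :=
  forall x x' y, T y x <= expR eps * T y x'.

(* [users] is the number n of users and [rule i] is the channel of user [i].
   [test] is only ever applied to sequences of length n > 0. *)
Record test_rule (k : nat) := TestRule {
  users : nat ;
  test : seq nat -> {ffun 'I_k -> R} ;
  rule : 'I_users -> nat -> 'I_k -> R }.

Definition is_test_rule (k : nat) (p q : {ffun 'I_k -> R}) (eps : R)
    (t : test_rule k) : Prop :=
  (forall s, test t s = p \/ test t s = q) /\
  (forall i, channel (rule (t := t) i) /\ LDP eps (rule (t := t) i)).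

(* The probability that (Y_1, ..., Y_n) is in [A] when the X_i are i.i.d. with
   law [p] and, given the X_i, the Y_i = T_i(X_i) are drawn independently. *)
Definition output_prob (k n : nat) (p : {ffun 'I_k -> R})
    (T : 'I_n -> nat -> 'I_k -> R) (A : set (n.-tuple nat)) : \bar R :=
  (\sum_(x : {ffun 'I_n -> 'I_k})
     (\prod_(i < n) p (x i))%:E *
     \esum_(y in A) (\prod_(i < n) T i (tnth y i) (x i))%:E)%E.

Definition solves (k : nat) (p q : {ffun 'I_k -> R}) (eps : R)
    (t : test_rule k) : Prop :=
  [/\ (0 < users t)%N, is_test_rule p q eps t &
   (output_prob p (@rule _ t) [set y : (users t).-tuple nat | test t y <> p] +
    output_prob q (@rule _ t) [set y : (users t).-tuple nat | test t y <> q]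
      <= (10^-1)%:E)%E].

(* +oo if no test-rule pair solves the problem *)
Definition nstar (k : nat) (p q : {ffun 'I_k -> R}) (eps : R) : \bar R :=
  ereal_inf [set ((users t)%:R)%:E | t in solves p q eps].

Definition Sclass (rho nu : R) (k : nat) (p q : {ffun 'I_k -> R}) : Prop :=
  [/\ simplex p, simplex q, dTV p q = nu & dhel2 p q = rho].

(* The maximum over S of n*(p, q, eps).  A test-rule pair may depend on the
   known pair (p, q), so the minimum over (phi, R) in the definition of the
   minimax sample complexity ranges over families of test-rule pairs indexed
   by (p, q); [nstar_minimaxE] below shows that this min-max is the same
   quantity. *)
Definition nstar_minimax (rho nu eps : R) : \bar R :=
  ereal_sup [set v | exists (k : nat) (p q : {ffun 'I_k -> R}),
    Sclass rho nu p q /\ v = nstar p q eps].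

Definition strategy :=
  forall k : nat, {ffun 'I_k -> R} -> {ffun 'I_k -> R} -> test_rule k.

Definition worst_users (rho nu : R) (T : strategy) : \bar R :=
  ereal_sup [set v | exists (k : nat) (p q : {ffun 'I_k -> R}),
    Sclass rho nu p q /\ v = ((users (T k p q))%:R)%:E].

Definition strategy_solves (rho nu eps : R) (T : strategy) : Prop :=
  forall k (p q : {ffun 'I_k -> R}), Sclass rho nu p q ->
    solves p q eps (T k p q).

Lemma nstar_attained (k : nat) (p q : {ffun 'I_k -> R}) (eps : R) :
  (exists t, solves p q eps t) ->
  exists2 t, solves p q eps t & nstar p q eps = ((users t)%:R)%:E.
Proof.
move=> [t0 st0].
pose P n := `[< exists2 t, solves p q eps t & users t = n >].
have exP : exists n, P n by exists (users t0); apply/asboolP; exists t0.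
case: (ex_minnP exP) => n /asboolP [t st nt] minn; exists t => //.
apply/eqP; rewrite eq_le; apply/andP; split.
  by apply: ereal_inf_lbound; exists t.
apply: le_ereal_inf_tmp => _ [t' st' <-].
by rewrite lee_fin ler_nat nt; apply: minn; apply/asboolP; exists t'.
Qed.

Lemma nstar_minimaxE (rho nu eps : R) :
  nstar_minimax rho nu eps =
  ereal_inf [set worst_users rho nu T | T in strategy_solves rho nu eps].
Proof.
apply/eqP; rewrite eq_le; apply/andP; split.
  apply: le_ereal_inf_tmp => _ [T sT <-].
  apply: ge_ereal_sup => _ [k [p [q [Spq ->]]]].
  apply: (@le_trans _ _ ((users (T k p q))%:R)%:E).
    by apply: ereal_inf_lbound; exists (T k p q) => //; exact: sT.
  by apply: ereal_sup_ubound; exists k, p, q.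
have [sol|] := pselect (forall k (p q : {ffun 'I_k -> R}), Sclass rho nu p q ->
    exists t, solves p q eps t); last first.
  move=> /existsNP [k] /existsNP [p] /existsNP [q] /not_implyP [Spq nsol].
  suff -> : nstar_minimax rho nu eps = +oo%E by rewrite leey.
  apply/eqP; rewrite -leye_eq; apply: ereal_sup_ubound.
  exists k, p, q; split => //; rewrite /nstar.
  rewrite (_ : [set _ | _ in _] = set0) ?ereal_inf0//.
  by rewrite -subset0 => x [t st _]; apply: nsol; exists t.
have best k (p q : {ffun 'I_k -> R}) : exists t : test_rule k,
    Sclass rho nu p q ->
    solves p q eps t /\ nstar p q eps = ((users t)%:R)%:E.
  have [Spq|nSpq] := pselect (Sclass rho nu p q).
    by have [t st tE] := nstar_attained (sol k p q Spq); exists t.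
  by exists (@TestRule k 0 (fun _ => p) (fun _ _ _ => 0)).
pose T : strategy := fun k p q => projT1 (cid (best k p q)).
have TP k (p q : {ffun 'I_k -> R}) (Spq : Sclass rho nu p q) :
    solves p q eps (T k p q) /\ nstar p q eps = ((users (T k p q))%:R)%:E.
  exact: projT2 (cid (best k p q)) Spq.
apply: (@le_trans _ _ (worst_users rho nu T)).
  by apply: ereal_inf_lbound; exists T => // k p q /TP [].
apply: ge_ereal_sup => _ [k [p [q [Spq ->]]]].
by apply: ereal_sup_ubound; exists k, p, q; split => //; case: (TP k p q Spq).
Qed.

(* [x] is within a factor C * log^m of [y].  As rho, nu < 1/2, the sum L of
   logarithms exceeds 1, so every poly-logarithmic factor in 1/nu and 1/rho is
   at most C * L ^ m for suitable C and m. *)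
Definition tilde_Theta (C : R) (m : nat) (rho nu : R) (x : \bar R) (y : R)
    : Prop :=
  let L := ln nu^-1 + ln rho^-1 in
  ((y / (C * L ^+ m))%:E <= x <= (C * L ^+ m * y)%:E)%E.

End Distributions.

(* Main.v *)
Require Import Defs.
From mathcomp Require Import all_boot all_order all_algebra.
From mathcomp Require Import all_classical all_reals all_analysis.
From mathcomp Require Import ring lra.

(* Upper bounds.  Let p and q be merged to the two points of a set S and its
   complement, and let the bit be sent by randomized response, i.e. flipped with
   probability d = 1 / (1 + e^eps).  The likelihood-ratio test then errs with
   probability at most the n-th power of the affinity of the two output laws,
   which is small once n ((1 - 2 d) (p(S) - q(S)))^2 >= 36 (2 d + p(S) + q(S)).
   The Scheffe set gives 1/nu^2.  For the bound through rho, split the points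
   into dyadic bands according to |p - q| / (p + q): some band among the first
   O(log (1/rho)) carries a comparable share of the Hellinger distance, and for
   such a band S, (p(S) - q(S))^2 >= r (p(S) + q(S)) with r of order
   rho / log (1/rho).

   Lower bounds.  The affinity of product laws is the product of the affinities,
   so n users can succeed only if n B is bounded below, where B bounds the squared
   Hellinger distance of the laws of one user's output.  The bound is applied to
   the pair p = (al, 0, c, d), q = (0, al, d, c), in which the first two points
   carry most of rho and the last two most of nu.  Because of the privacy
   constraint, the mass at the last two points dominates the output
   probabilities coming from the first two up to a factor e^eps. *)

Set Implicit Arguments.
Unset Strict Implicit.
Unset Printing Implicit Defensive.

Import Order.TTheory GRing.Theory Num.Theory.

Local Open Scope classical_set_scope.
Local Open Scope ring_scope.

(** * Sums and affinities *)

(** Lagrange's identity: the gap between the two sides is half the double sum of the squares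
    [(u i * v j - u j * v i) ^+ 2]. *)
Lemma cauchy_schwarz_sum (R : realFieldType) (I : finType) (u v : I -> R) :
  (\sum_i u i * v i) ^+ 2 <= (\sum_i u i ^+ 2) * (\sum_i v i ^+ 2).
Proof.
have : 0 <= \sum_i \sum_j (u i * v j - u j * v i) ^+ 2.
  by apply: sumr_ge0 => i _; apply: sumr_ge0 => j _; exact: sqr_ge0.
have -> : \sum_i \sum_j (u i * v j - u j * v i) ^+ 2 =
  2 * ((\sum_i u i ^+ 2) * (\sum_i v i ^+ 2) - (\sum_i u i * v i) ^+ 2).
  rewrite expr2 !big_distrlr /= mulrBr [2]mulr2n mulrDl mul1r.
  rewrite {2}[\sum_i \sum_j u i ^+ 2 * v j ^+ 2]exchange_big -big_split.
  rewrite mulr_sumr -sumrB /=; apply: eq_bigr => i _.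
  rewrite -big_split mulr_sumr -sumrB /=; apply: eq_bigr => j _; ring.
by lra.
Qed.

Lemma affinity_sqr_le (R : rcfType) (I : finType) (P : pred I) (u v : I -> R) :
  (forall i, 0 <= u i) -> (forall i, 0 <= v i) ->
  (\sum_(i | P i) Num.sqrt (u i * v i)) ^+ 2 <=
  (\sum_(i | P i) u i) * (\sum_(i | P i) v i).
Proof.
move=> u0 v0.
pose f (w : I -> R) i := if P i then Num.sqrt (w i) else 0.
have sq w : (forall i, 0 <= w i) -> \sum_(i | P i) w i = \sum_i f w i ^+ 2.
  move=> w0; rewrite big_mkcond; apply: eq_bigr => i _; rewrite /f.
  by case: ifP => _; rewrite ?sqr_sqrtr ?expr0n.
rewrite (sq u)// (sq v)//.
suff -> : \sum_(i | P i) Num.sqrt (u i * v i) = \sum_i f u i * f v i.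
  exact: cauchy_schwarz_sum.
rewrite big_mkcond; apply: eq_bigr => i _; rewrite /f.
by case: ifP => _; rewrite ?mulr0// sqrtrM.
Qed.

(** The Weierstrass product inequality. The upper bound is carried along because the inductive step
    uses that the remaining product is at most 1. *)
Lemma prodr_ge_1Bsum (R : realFieldType) (I : Type) (s : seq I) (c : I -> R) :
  (forall i, 0 <= c i <= 1) ->
  1 - \sum_(i <- s) (1 - c i) <= \prod_(i <- s) c i <= 1.
Proof.
move=> c01; elim: s => [|i s /andP[IH1 IH2]]; first by rewrite !big_nil; lra.
have P0 : 0 <= \prod_(j <- s) c j.
  by apply: prodr_ge0 => j _; case/andP: (c01 j).
rewrite !big_cons; have /andP[c0 c1] := c01 i; nra.
Qed.

Lemma sqrt_prod (R : rcfType) (I : Type) (s : seq I) (F : I -> R) :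
  (forall i, 0 <= F i) ->
  Num.sqrt (\prod_(i <- s) F i) = \prod_(i <- s) Num.sqrt (F i).
Proof.
move=> F0; elim: s => [|i s IH]; first by rewrite !big_nil sqrtr1.
by rewrite !big_cons sqrtrM// IH.
Qed.

Lemma min_le_sqrtM (R : rcfType) (x y : R) :
  0 <= x -> 0 <= y -> Num.min x y <= Num.sqrt (x * y).
Proof.
move=> x0 y0; have m0 : 0 <= Num.min x y by rewrite le_min x0.
rewrite -(ger0_norm m0) -sqrtr_sqr ler_sqrt ?mulr_ge0// expr2.
by rewrite ler_pM// ge_min lexx ?orbT.
Qed.

(** Le Cam's inequality: no test has total error below the sum of the minima. Since [u i * v i] is
    minimum times maximum, Cauchy-Schwarz applies, and the maxima sum to at most 2. *)
Lemma sqr_affinity_le_min (R : rcfType) (I : finType) (u v : I -> R) :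
  (forall i, 0 <= u i) -> (forall i, 0 <= v i) ->
  \sum_i u i <= 1 -> \sum_i v i <= 1 ->
  (\sum_i Num.sqrt (u i * v i)) ^+ 2 <= 2 * \sum_i Num.min (u i) (v i).
Proof.
move=> u0 v0 u1 v1.
have m0 i : 0 <= Num.min (u i) (v i) by rewrite le_min u0 v0.
have M0 i : 0 <= Num.max (u i) (v i) by rewrite le_max u0.
have mM i : u i * v i = Num.min (u i) (v i) * Num.max (u i) (v i).
  by case: leP => // _; rewrite mulrC.
under eq_bigr do rewrite mM.
apply: le_trans (affinity_sqr_le _ m0 M0) _ => //.
rewrite mulrC ler_wpM2r ?sumr_ge0//.
apply: (@le_trans _ _ (\sum_i (u i + v i))); last by rewrite big_split/=; lra.
apply: ler_sum => i _; rewrite -addr_min_max; move: (m0 i); lra.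
Qed.

Lemma sqrt_diff_sqr (R : rcfType) (x y : R) : 0 <= x -> 0 <= y ->
  (Num.sqrt x - Num.sqrt y) ^+ 2 = x + y - 2 * Num.sqrt (x * y).
Proof.
move=> x0 y0; rewrite sqrrB !sqr_sqrtr// sqrtrM//; ring.
Qed.

(** With a and b the square roots, [x - y] factors as (a + b)(a - b), and (a + b)^2 lies between x +
    y and 2 (x + y). Stated without division, so that x = y = 0 is allowed. *)
Lemma sqrt_diff_sqr_bounds (R : rcfType) (x y : R) : 0 <= x -> 0 <= y ->
  (x - y) ^+ 2 <= 2 * (x + y) * (Num.sqrt x - Num.sqrt y) ^+ 2 /\
  (x + y) * (Num.sqrt x - Num.sqrt y) ^+ 2 <= (x - y) ^+ 2.
Proof.
move=> x0 y0; set a := Num.sqrt x; set b := Num.sqrt y.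
have a0 : 0 <= a by exact: sqrtr_ge0.
have b0 : 0 <= b by exact: sqrtr_ge0.
have -> : x = a ^+ 2 by rewrite sqr_sqrtr.
have -> : y = b ^+ 2 by rewrite sqr_sqrtr.
have -> : (a ^+ 2 - b ^+ 2) ^+ 2 = (a + b) ^+ 2 * (a - b) ^+ 2 by ring.
have d0 : 0 <= (a - b) ^+ 2 by exact: sqr_ge0.
by split; rewrite ler_wpM2r//; [have := d0|have : 0 <= a * b by exact: mulr_ge0]; nra.
Qed.

(** * Laws of the outputs *)

Definition law {R : realType} {k : nat} (p : {ffun 'I_k -> R})
    (T : nat -> 'I_k -> R) (y : nat) : R := \sum_x p x * T y x.

(** Finite functions index the output vectors with entries below [N], so that sums over them factor
    by distributivity over the users. *)
Definition box_tuple {n N : nat} (w : {ffun 'I_n -> 'I_N}) : n.-tuple nat :=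
  [tuple nat_of_ord (w i) | i < n].

Lemma box_tuple_inj (n N : nat) : injective (@box_tuple n N).
Proof.
move=> v w /(congr1 (fun t => tnth t)) vw; apply/ffunP => i; apply: val_inj.
by move: (congr1 (@^~ i) vw); rewrite !tnth_mktuple.
Qed.

Lemma box_seqE (R : realType) (n N : nat) (A : set (n.-tuple nat))
    (f : n.-tuple nat -> \bar R) :
  let s := [seq box_tuple w |
    w <- enum [pred w : {ffun 'I_n -> 'I_N} | box_tuple w \in A]] in
  [/\ uniq s, [set` s] `<=` A &
      (\sum_(y <- s) f y =
       \sum_(w : {ffun 'I_n -> 'I_N} | box_tuple w \in A) f (box_tuple w))%E].
Proof.
split; first by rewrite map_inj_uniq ?enum_uniq//; exact: box_tuple_inj.
  by move=> y /= /mapP[w]; rewrite mem_enum unfold_in /= => /set_mem wA ->.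
by rewrite big_map big_enum.
Qed.

Lemma sum_box_le_esum (R : realType) (n N : nat) (A : set (n.-tuple nat))
    (f : n.-tuple nat -> \bar R) :
  (\sum_(w : {ffun 'I_n -> 'I_N} | box_tuple w \in A) f (box_tuple w)
    <= \esum_(y in A) f y)%E.
Proof.
have [us sA <-] := @box_seqE R n N A f.
apply: esum_ge; eexists; last by rewrite (fsbig_seq _ _ us).
by split => //; exact: finite_seq.
Qed.

Lemma esum_box (R : realType) (n N : nat) (A : set (n.-tuple nat))
    (f : n.-tuple nat -> \bar R) :
  (forall y, (0 <= f y)%E) ->
  (forall y, (exists i, (N <= tnth y i)%N) -> f y = 0%E) ->
  (\esum_(y in A) f y =
   \sum_(w : {ffun 'I_n -> 'I_N} | box_tuple w \in A) f (box_tuple w))%E.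
Proof.
move=> f0 fN; have [us sA <-] := @box_seqE R n N A f.
rewrite (fsbig_seq _ _ us) -esum_fset => [|//|i _]; last exact: f0.
rewrite esum_mkcond [RHS]esum_mkcond; apply: eq_esum => y _.
case: ifPn => yA; case: ifPn => ys => //.
  apply: fN; apply: contrapT => /forallNP yN; case/negP: ys; rewrite inE /=.
  have yN' i : (tnth y i < N)%N by rewrite ltnNge; apply/negP/yN.
  pose w : {ffun 'I_n -> 'I_N} := [ffun i => Ordinal (yN' i)].
  have yw : y = box_tuple w.
    by apply: eq_from_tnth => i; rewrite tnth_mktuple ffunE.
  by rewrite yw; apply: map_f; rewrite mem_enum unfold_in /= -yw.
by move: ys yA; rewrite inE notin_setE => /sA.
Qed.

(** Distributivity sums out the independent inputs and leaves the product of the users' output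
    laws. *)
Lemma output_prob_law (R : realType) (k n N : nat) (p : {ffun 'I_k -> R})
    (T : 'I_n -> nat -> 'I_k -> R) (A : set (n.-tuple nat)) :
  (\sum_(x : {ffun 'I_n -> 'I_k})
     (\prod_(i < n) p (x i))%:E *
     \sum_(w : {ffun 'I_n -> 'I_N} | box_tuple w \in A)
       (\prod_(i < n) T i (tnth (box_tuple w) i) (x i))%:E =
   (\sum_(w : {ffun 'I_n -> 'I_N} | box_tuple w \in A)
     \prod_(i < n) law p (T i) (w i))%:E)%E.
Proof.
under eq_bigr do rewrite sumEFin -EFinM mulr_sumr.
rewrite sumEFin exchange_big /=; congr EFin; apply: eq_bigr => w _.
rewrite bigA_distr_bigA /=; apply: eq_bigr => x _.
by rewrite -big_split /=; apply: eq_bigr => i _; rewrite tnth_mktuple.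
Qed.

(** For arbitrary channels truncation only loses mass, and this direction is what the lower bounds
    call for. *)
Lemma output_prob_box_le (R : realType) (k n N : nat) (p : {ffun 'I_k -> R})
    (T : 'I_n -> nat -> 'I_k -> R) (A : set (n.-tuple nat)) :
  (forall x, 0 <= p x) ->
  ((\sum_(w : {ffun 'I_n -> 'I_N} | box_tuple w \in A)
     \prod_(i < n) law p (T i) (w i))%:E <= output_prob p T A)%E.
Proof.
move=> p0; rewrite -output_prob_law; apply: lee_sum => x _.
by rewrite lee_wpmul2l ?lee_fin ?prodr_ge0// sum_box_le_esum.
Qed.

Lemma output_prob_box (R : realType) (k n N : nat) (p : {ffun 'I_k -> R})
    (T : 'I_n -> nat -> 'I_k -> R) (A : set (n.-tuple nat)) :
  (forall i y x, 0 <= T i y x) ->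
  (forall i y x, (N <= y)%N -> T i y x = 0) ->
  output_prob p T A = (\sum_(w : {ffun 'I_n -> 'I_N} | box_tuple w \in A)
     \prod_(i < n) law p (T i) (w i))%:E.
Proof.
move=> T0 TN; rewrite -output_prob_law; apply: eq_bigr => x _.
rewrite (@esum_box _ _ N)// => y; first by rewrite lee_fin prodr_ge0.
by move=> [i yi]; rewrite (bigD1 i)//= TN// mul0r.
Qed.

(** For each input the partial sums increase to 1, and there are finitely many inputs, so the
    largest of their thresholds serves all of them. *)
Lemma channel_truncate (R : realType) (k : nat) (T : nat -> 'I_k -> R) (eta : R) :
  channel T -> 0 < eta ->
  exists N0, forall N, (N0 <= N)%N -> forall x,
    1 - eta <= \sum_(y < N) T y x <= 1.
Proof.
move=> [T0 T1] eta0.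
have S1 x N : \sum_(y < N) T y x <= 1.
  rewrite -lee_fin -(T1 x) -sumEFin (fsbig_ord _ N (fun y : nat => (T y x)%:E)).
  by apply: esum_ge; exists `I_N => //; split => //; exact: finite_II.
have S2 x : exists N0, 1 - eta <= \sum_(y < N0) T y x.
  apply: contrapT => /forallNP nS.
  suff: (1%:E <= (1 - eta)%:E :> \bar R)%E by rewrite lee_fin; lra.
  rewrite -[leLHS](T1 x) -nneseries_esumT; last by move=> i; rewrite lee_fin.
  apply: lime_le; first by apply: is_cvg_nneseries => i _ _; rewrite lee_fin.
  apply: nearW => N; rewrite sumEFin lee_fin big_mkord ltW// ltNge.
  exact/negP/nS.
have [N0 N0P] := choice S2.
exists (\max_x N0 x)%N => N leN x; rewrite S1 andbT.
apply: le_trans (N0P x) _.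
rewrite -!(big_mkord xpredT (fun y => T y x)) [leRHS](big_cat_nat _ (n := N0 x))//=.
  by rewrite lerDl sumr_ge0.
by apply: leq_trans leN; exact: leq_bigmax.
Qed.

(** * Lower bounds *)

Lemma law_ge0 (R : realType) (k : nat) (p : {ffun 'I_k -> R})
    (T : nat -> 'I_k -> R) y :
  (forall x, 0 <= p x) -> (forall x, 0 <= T y x) -> 0 <= law p T y.
Proof. by move=> p0 T0; apply: sumr_ge0 => x _; rewrite mulr_ge0. Qed.

Lemma law_sum (R : realType) (k N : nat) (p : {ffun 'I_k -> R})
    (T : nat -> 'I_k -> R) :
  \sum_(y < N) law p T y = \sum_x p x * \sum_(y < N) T y x.
Proof. by rewrite exchange_big; apply: eq_bigr => x _; rewrite mulr_sumr. Qed.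

Lemma product_mass (R : realType) (k n N : nat) (p : {ffun 'I_k -> R})
    (T : 'I_n -> nat -> 'I_k -> R) :
  \sum_(w : {ffun 'I_n -> 'I_N}) \prod_(i < n) law p (T i) (w i) =
  \prod_(i < n) \sum_(y < N) law p (T i) y.
Proof. by rewrite bigA_distr_bigA. Qed.

Lemma product_affinity (R : realType) (k n N : nat) (p q : {ffun 'I_k -> R})
    (T : 'I_n -> nat -> 'I_k -> R) :
  (forall x, 0 <= p x) -> (forall x, 0 <= q x) -> (forall i y x, 0 <= T i y x) ->
  \sum_(w : {ffun 'I_n -> 'I_N})
    Num.sqrt ((\prod_(i < n) law p (T i) (w i)) * \prod_(i < n) law q (T i) (w i)) =
  \prod_(i < n) \sum_(y < N) Num.sqrt (law p (T i) y * law q (T i) y).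
Proof.
move=> p0 q0 T0; rewrite bigA_distr_bigA; apply: eq_bigr => w _.
by rewrite -big_split /= sqrt_prod// => i; rewrite mulr_ge0// law_ge0.
Qed.

(** Le Cam's method on a truncated box. Success forces the squared affinity of the product laws down
    to 1/5, whereas it is at least 1 - (1/5 + n B), where 1/5 pays for the truncation. *)
Lemma solves_users_ge (R : realType) (k : nat) (p q : {ffun 'I_k -> R})
    (eps B : R) (t : test_rule k) :
  simplex p -> simplex q -> p <> q -> solves p q eps t ->
  (forall T, channel T -> LDP eps T -> forall N,
     \sum_(y < N) (Num.sqrt (law p T y) - Num.sqrt (law q T y)) ^+ 2 <= B) ->
  3 / 5 <= (users t)%:R * B.
Proof.
case: t => n test T [p0 p1] [q0 q1] pq [/= n0 [/= testpq chT] err] HB.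
have n0' : (0 : R) < n%:R by rewrite ltr0n.
(* Chosen so that the total truncation loss [2 * n * eta] is 1/5. *)
pose eta : R := (10 * n%:R)^-1.
have eta0 : 0 < eta by rewrite invr_gt0 mulr_gt0.
have neta : n%:R * eta = 10^-1.
  by rewrite /eta invfM mulrCA mulfV ?mulr1// gt_eqF.
have T0 i y x : 0 <= T i y x by case: (chT i) => -[].
have [N0 N0P] := choice (fun i => channel_truncate (proj1 (chT i)) eta0).
pose N := (\max_i N0 i)%N.
have mass (r : {ffun 'I_k -> R}) i : (forall x, 0 <= r x) -> \sum_x r x = 1 ->
    1 - eta <= \sum_(y < N) law r (T i) y <= 1.
  move=> r0 r1; rewrite law_sum.
  have h x := N0P i N (leq_bigmax i) x.
  rewrite -[X in X <= _]mul1r -{1}r1 -{2}r1 mulr_suml.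
  by apply/andP; split; apply: ler_sum => x _; case/andP: (h x) => h1 h2;
    [exact: ler_wpM2l|exact: ler_piMr].
pose BC i := \sum_(y < N) Num.sqrt (law p (T i) y * law q (T i) y).
have l0 (r : {ffun 'I_k -> R}) : (forall x, 0 <= r x) ->
    forall i y, 0 <= law r (T i) y by move=> r0 i y; exact: law_ge0.
have BCE i : 1 - eta - B / 2 <= BC i <= 1.
  have := HB _ (chT i).1 (chT i).2 N.
  have D0 : 0 <= \sum_(y < N) (Num.sqrt (law p (T i) y) - Num.sqrt (law q (T i) y)) ^+ 2.
    by apply: sumr_ge0 => y _; exact: sqr_ge0.
  move: D0; under eq_bigr => y _ do rewrite sqrt_diff_sqr ?l0//.
  rewrite sumrB big_split /= -mulr_sumr -/(BC i).
  move: (mass p i p0 p1) (mass q i q0 q1); lra.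
have BC0 i : 0 <= BC i by apply: sumr_ge0 => y _; exact: sqrtr_ge0.
pose P (r : {ffun 'I_k -> R}) (w : {ffun 'I_n -> 'I_N}) :=
  \prod_(i < n) law r (T i) (w i).
have P0 (r : {ffun 'I_k -> R}) w : (forall x, 0 <= r x) -> 0 <= P r w.
  by move=> r0; apply: prodr_ge0 => i _; exact: l0.
have P1 (r : {ffun 'I_k -> R}) : (forall x, 0 <= r x) -> \sum_x r x = 1 ->
    \sum_w P r w <= 1.
  move=> r0 r1; rewrite product_mass.
  have c01 i : 0 <= \sum_(y < N) law r (T i) y <= 1.
    have /andP[_ ->] := mass r i r0 r1.
    by rewrite andbT sumr_ge0// => y _; exact: l0.
  by have /andP[] := prodr_ge_1Bsum (index_enum 'I_n) c01.
have errB : \sum_w Num.min (P p w) (P q w) <= 10^-1.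
  rewrite -lee_fin; apply: le_trans err.
  apply: le_trans (leeD (@output_prob_box_le _ _ _ N _ _ _ p0)
                        (@output_prob_box_le _ _ _ N _ _ _ q0)).
  rewrite -EFinD lee_fin [X in _ <= X + _]big_mkcond [X in _ <= _ + X]big_mkcond -big_split /=.
  apply: ler_sum => w _; rewrite -/(P p w) -/(P q w).
  have m0 : 0 <= Num.min (P p w) (P q w) by rewrite le_min !P0.
  (* Whatever the test answers at [w], it is wrong under [p] or under [q], so one of the two masses
     is counted in full. *)
  have [tp|tp] := pselect (test (box_tuple w) = p).
    rewrite [X in _ + X]ifT.
      by apply: le_trans (_ : P q w <= _); rewrite ?ge_min ?lexx ?orbT// lerDr; case: ifP; rewrite ?P0.
    by rewrite inE /= tp.
  rewrite ifT ?inE//.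
  by apply: le_trans (_ : P p w <= _); rewrite ?ge_min ?lexx// lerDl; case: ifP; rewrite ?P0.
have := @sqr_affinity_le_min _ _ (P p) (P q) (fun w => P0 p w p0)
  (fun w => P0 q w q0) (P1 p p0 p1) (P1 q q0 q1).
rewrite product_affinity// -prodrXl => aff.
have BC2 i : 0 <= BC i ^+ 2 <= 1.
  by rewrite sqr_ge0 expr_le1//; case/andP: (BCE i).
have /andP[+ _] := prodr_ge_1Bsum (index_enum 'I_n) BC2.
have : \sum_(i < n) (1 - BC i ^+ 2) <= \sum_(i < n) (2 * eta + B).
  (* Here 1 - c^2 <= 2 (1 - c), which is at most 2 eta + B by [BCE]. *)
  apply: ler_sum => i _; have := sqr_ge0 (1 - BC i).
  rewrite sqrrB expr1n mul1r mulr2n; move: (BCE i); lra.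
have -> : \sum_(i < n) (2 * eta + B) = 5^-1 + n%:R * B.
  by rewrite sumr_const card_ord -[LHS]mulr_natl mulrDr mulrCA neta; lra.
move=> h1 h2.
by move: h1 h2 aff errB; rewrite /BC; lra.
Qed.

(** For each output [y], Cauchy-Schwarz applied to [p x * T y x] and [q x * T y x] bounds the loss
    by an average over the inputs. The weights [T y x] then sum to at most 1 over the outputs. *)
Lemma hellinger_data_processing (R : realType) (k N : nat)
    (p q : {ffun 'I_k -> R}) (T : nat -> 'I_k -> R) :
  (forall x, 0 <= p x) -> (forall x, 0 <= q x) -> channel T ->
  \sum_(y < N) (Num.sqrt (law p T y) - Num.sqrt (law q T y)) ^+ 2 <= dhel2 p q.
Proof.
move=> p0 q0 chT; have [T0 _] := chT.
have l0 (r : {ffun 'I_k -> R}) y : (forall x, 0 <= r x) -> 0 <= law r T y.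
  by move=> r0; exact: law_ge0.
apply: (@le_trans _ _ (\sum_(y < N) \sum_x
    T y x * (Num.sqrt (p x) - Num.sqrt (q x)) ^+ 2)).
  apply: ler_sum => y _; rewrite sqrt_diff_sqr ?l0//.
  under eq_bigr => x _ do rewrite sqrt_diff_sqr// mulrBr mulrDr
    [T y x * p x]mulrC [T y x * q x]mulrC [T y x * _]mulrCA.
  rewrite sumrB big_split /= -mulr_sumr lerD2l lerN2 ler_pM2l//.
  rewrite -ler_sqr ?nnegrE ?sqrtr_ge0//; last first.
    by apply: sumr_ge0 => x _; rewrite mulr_ge0 ?sqrtr_ge0.
  rewrite sqr_sqrtr ?mulr_ge0 ?l0//.
  have := @affinity_sqr_le _ _ xpredT (fun x => p x * T y x) (fun x => q x * T y x).
  under eq_bigr => x _ do rewrite mulrACA sqrtrM ?mulr_ge0// -expr2 sqrtr_sqr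
    ger0_norm// mulrC.
  by apply => x; rewrite mulr_ge0.
rewrite exchange_big; apply: ler_sum => x _; rewrite -mulr_suml.
rewrite ler_piMl ?sqr_ge0//.
(* Only the upper bound of the truncation lemma is used, hence the crude choice of 1 for [eta]. *)
have [N0 /(_ (maxn N N0) (leq_maxr _ _) x)/andP[_]] := channel_truncate chT ltr01.
apply: le_trans; rewrite -!(big_mkord xpredT (fun y => T y x)).
by rewrite [leRHS](big_cat_nat _ (n := N))//= ?leq_maxl// lerDl sumr_ge0.
Qed.

(** * The hard pair on four points *)

Definition hard_fst {R : realType} (nu al : R) : {ffun 'I_4 -> R} :=
  [ffun i => tnth [tuple al; 0; (1 + nu) / 2 - al; (1 - nu) / 2] i].

Definition hard_snd {R : realType} (nu al : R) : {ffun 'I_4 -> R} :=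
  [ffun i => tnth [tuple 0; al; (1 - nu) / 2; (1 + nu) / 2 - al] i].

(* The solution of [2 - 4 * sqrt (((1 + nu) / 2 - al) * ((1 - nu) / 2)) = rho]. *)
Definition hard_mass {R : realType} (rho nu : R) : R :=
  (1 + nu - (1 - rho / 2) ^+ 2 / (1 - nu)) / 2.

(** The bound 2 nu^2 <= rho gives al >= 0, rho <= nu gives al <= nu, and the AM-GM inequality for
    the last two masses, whose sum is 1 - al, gives al <= rho / 2. *)
Lemma hard_mass_bounds (R : realType) (rho nu : R) :
  0 < rho < 2^-1 -> 0 < nu < 2^-1 -> 2 * nu ^+ 2 <= rho <= nu ->
  let al := hard_mass rho nu in
  [/\ 0 <= al, al <= nu, al <= rho / 2 &
      ((1 + nu) / 2 - al) * ((1 - nu) / 2) = ((1 - rho / 2) / 2) ^+ 2].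
Proof.
move=> hrho hnu hrn al.
have E : ((1 + nu) / 2 - al) * ((1 - nu) / 2) = ((1 - rho / 2) / 2) ^+ 2.
  by rewrite /al /hard_mass; field; lra.
have al0 : 0 <= al.
  have : (1 - rho / 2) ^+ 2 <= 1 - nu ^+ 2 by nra.
  by move=> x; rewrite leNgt; apply/negP => h; nra.
have aln : al <= nu.
  have : (1 - nu) ^+ 2 <= (1 - rho / 2) ^+ 2 by nra.
  by move=> x; rewrite leNgt; apply/negP => h; nra.
split => //; suff : 1 - rho / 2 <= 1 - al by lra.
by rewrite -ler_sqr ?nnegrE; [nra|lra|lra].
Qed.

(** The last two masses differ by nu - al, so the total variation al + (nu - al) is nu for every
    admissible al. The Hellinger distance is 2 - 4 sqrt(c d), which the choice of al makes equal to
    rho. *)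
Lemma hard_pair_class (R : realType) (rho nu : R) :
  0 < rho < 2^-1 -> 0 < nu < 2^-1 -> 2 * nu ^+ 2 <= rho <= nu ->
  let al := hard_mass rho nu in Sclass rho nu (hard_fst nu al) (hard_snd nu al).
Proof.
move=> hrho hnu hrn /=; have /= := hard_mass_bounds hrho hnu hrn.
move: (hard_mass rho nu) => al [al0 aln alr alE].
have c0 : 0 <= (1 + nu) / 2 - al by lra.
have d0 : 0 <= (1 - nu) / 2 by lra.
split.
- split; last by rewrite !big_ord_recl big_ord0 !ffunE !(tnth_nth 0) /=; field.
  by move=> i; rewrite ffunE (tnth_nth 0); case: i => -[|[|[|[|]]]].
- split; last by rewrite !big_ord_recl big_ord0 !ffunE !(tnth_nth 0) /=; field.
  by move=> i; rewrite ffunE (tnth_nth 0); case: i => -[|[|[|[|]]]].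
- rewrite /dTV !big_ord_recl big_ord0 !ffunE !(tnth_nth 0) /=.
  rewrite subr0 sub0r normrN [`|(1 - nu) / 2 - _|]distrC (ger0_norm al0).
  by rewrite ger0_norm; [field|lra].
- rewrite /dhel2 !big_ord_recl big_ord0 !ffunE !(tnth_nth 0) /=.
  rewrite !sqrt_diff_sqr; try lra.
  rewrite mulr0 mul0r sqrtr0 [(1 - nu) / 2 * _]mulrC alE sqrtr_sqr ger0_norm; lra.
Qed.

Lemma law_ord4 (R : realType) (p : {ffun 'I_4 -> R}) T y :
  law p T y = p 0 * T y 0 + p 1 * T y 1 + p 2%:R * T y 2%:R + p 3%:R * T y 3%:R.
Proof.
rewrite /law !big_ord_recl big_ord0 addr0 !addrA.
by congr (_ + _ + _ + _); congr (p _ * T y _); apply: val_inj.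
Qed.

(** Each term is at most (P - Q)^2 / (P + Q), where P and Q are the two probabilities of the output.
    The denominator is at least half of [t3 + t4], and privacy bounds [t1 + t2] by e^eps times
    [t3 + t4]. The parameter [M] measures how far the channel can separate two inputs. *)
Lemma hard_pair_hellinger (R : realType) (nu al eps M : R) (T : nat -> 'I_4 -> R)
    (N : nat) :
  0 < nu < 2^-1 -> 0 <= al <= nu -> 0 <= M -> channel T -> LDP eps T ->
  (forall y x x', (T y x - T y x') ^+ 2 <= M * (T y x + T y x') ^+ 2) ->
  \sum_(y < N) (Num.sqrt (law (hard_fst nu al) T y) -
                Num.sqrt (law (hard_snd nu al) T y)) ^+ 2 <=
  8 * M * (al ^+ 2 * expR eps + nu ^+ 2).
Proof.
move=> hnu hal M0 chT LT TM; have [T0 _] := chT.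
have e0 : 0 < expR eps by exact: expR_gt0.
apply: (@le_trans _ _ (\sum_(y < N) 4 * M * (al ^+ 2 * expR eps *
   (T y 0 + T y 1) + nu ^+ 2 * (T y 2%:R + T y 3%:R)))).
  apply: ler_sum => y _; rewrite !law_ord4 !ffunE !(tnth_nth 0) /= !mul0r addr0 add0r.
  move: (T0 0 y) (T0 1 y) (T0 2%:R y) (T0 3%:R y) (TM y 0 1) (TM y 2%:R 3%:R)
    (LT 0 2%:R y) (LT 1 3%:R y).
  move: (T y 0) (T y 1) (T y 2%:R) (T y 3%:R) => t1 t2 t3 t4 h1 h2 h3 h4 m12 m34 l1 l2.
  set c := (1 + nu) / 2 - al; set d := (1 - nu) / 2.
  have cd : c - d = nu - al by rewrite /c /d; field.
  have d4 : 1 / 4 <= d by rewrite /d; lra.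
  have c4 : 1 / 4 <= c by lra.
  set K := al ^+ 2 * _ * _ + _.
  have ae : 0 <= al ^+ 2 * expR eps by rewrite mulr_ge0 ?sqr_ge0// ltW.
  have K0 : 0 <= 4 * M * K.
    rewrite mulr_ge0 ?mulr_ge0//; apply: addr_ge0.
      by apply: mulr_ge0 => //; exact: addr_ge0.
    by apply: mulr_ge0; [exact: sqr_ge0|exact: addr_ge0].
  have P0 : 0 <= al * t1 + c * t3 + d * t4 by rewrite !addr_ge0// mulr_ge0//; lra.
  have Q0 : 0 <= al * t2 + d * t3 + c * t4 by rewrite !addr_ge0// mulr_ge0//; lra.
  have [_] := sqrt_diff_sqr_bounds P0 Q0.
  have E : (al * t1 + c * t3 + d * t4) - (al * t2 + d * t3 + c * t4) =
      al * (t1 - t2) + (nu - al) * (t3 - t4) by rewrite -cd; ring.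
  have PQ : (t3 + t4) / 2 <= (al * t1 + c * t3 + d * t4) + (al * t2 + d * t3 + c * t4).
    by nra.
  rewrite E; move: P0 Q0 PQ; set P := al * t1 + _ + _; set Q := al * t2 + _ + _.
  move=> P0 Q0 PQ H.
  have X : (al * (t1 - t2) + (nu - al) * (t3 - t4)) ^+ 2 <= 2 * M * K * (t3 + t4).
    (* One of the two factors [t1 + t2] is traded for [t3 + t4] by privacy; the other is kept
       because it sums to at most 2 over the outputs. *)
    have X1 : (t1 - t2) ^+ 2 <= M * (expR eps * (t1 + t2) * (t3 + t4)).
      apply: le_trans m12 _; rewrite ler_wpM2l// expr2 [expR eps * _]mulrC -mulrA.
      by rewrite ler_wpM2l ?addr_ge0//; lra.
    have X2 : (t3 - t4) ^+ 2 <= M * ((t3 + t4) * (t3 + t4)) by rewrite -expr2.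
    have a2 : 0 <= al ^+ 2 by exact: sqr_ge0.
    have n2 : (nu - al) ^+ 2 <= nu ^+ 2.
      by rewrite ler_sqr ?nnegrE; lra.
    apply: (@le_trans _ _ (2 * (al ^+ 2 * (t1 - t2) ^+ 2) + 2 * ((nu - al) ^+ 2 * (t3 - t4) ^+ 2))).
      rewrite -!exprMn; have := sqr_ge0 (al * (t1 - t2) - (nu - al) * (t3 - t4)); nra.
    have Y1 := ler_wpM2l a2 X1.
    have Y2 : (nu - al) ^+ 2 * (t3 - t4) ^+ 2 <= nu ^+ 2 * (M * ((t3 + t4) * (t3 + t4))).
      by apply: ler_pM; rewrite ?sqr_ge0.
    rewrite /K; move: Y1 Y2; lra.
  (* [H] carries a factor [P + Q]; when it vanishes so do [P] and [Q]. *)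
  have [PQ0|PQ0] := ltP 0 (P + Q).
    rewrite -(ler_pM2l PQ0); apply: le_trans H _; apply: le_trans X _.
    rewrite [leRHS]mulrC; have : 0 <= M * K by lra.
    by nra.
  have -> : P = 0 by lra.
  have -> : Q = 0 by lra.
  by rewrite subrr expr0n.
rewrite -mulr_sumr big_split /= -!mulr_sumr !big_split /=.
have S x : \sum_(y < N) T y x <= 1.
  have [N0 /(_ (maxn N N0) (leq_maxr _ _) x)/andP[_]] := channel_truncate chT ltr01.
  apply: le_trans; rewrite -!(big_mkord xpredT (fun y => T y x)).
  by rewrite [leRHS](big_cat_nat _ (n := N))//= ?leq_maxl// lerDl sumr_ge0.
rewrite [8 * M](_ : _ = 4 * M * 2); last by ring.
rewrite -[leRHS]mulrA ler_wpM2l ?mulr_ge0//.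
have ae : 0 <= al ^+ 2 * expR eps by rewrite mulr_ge0 ?sqr_ge0// ltW.
have n2 := sqr_ge0 nu.
move: (S 0) (S 1) (S 2%:R) (S 3%:R) => s0 s1 s2 s3.
have := ler_wpM2l ae (lerD s0 s1); have := ler_wpM2l n2 (lerD s2 s3); lra.
Qed.

(** * Randomized response *)

Definition likelihood_test {R : realType} {k : nat} (p q : {ffun 'I_k -> R})
    (T : nat -> 'I_k -> R) (s : seq nat) : {ffun 'I_k -> R} :=
  if \prod_(y <- s) law q T y <= \prod_(y <- s) law p T y then p else q.

(** At each output vector exactly one of the two errors is counted, with weight the smaller of the
    two likelihoods. This is at most their geometric mean, whose sum is the n-th power of the
    affinity for one user. *)
Lemma solves_likelihood_test (R : realType) (k n N : nat)
    (p q : {ffun 'I_k -> R}) (eps : R) (T : nat -> 'I_k -> R) :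
  (forall x, 0 <= p x) -> (forall x, 0 <= q x) -> p <> q ->
  channel T -> LDP eps T -> (forall y x, (N <= y)%N -> T y x = 0) -> (0 < n)%N ->
  (\sum_(y < N) Num.sqrt (law p T y * law q T y)) ^+ n <= 10^-1 ->
  solves p q eps (@TestRule R k n (likelihood_test p q T) (fun _ => T)).
Proof.
move=> p0 q0 pq chT LT TN n0 BCn; have [T0 _] := chT.
split => //=; first split => //=.
  by move=> s; rewrite /likelihood_test; case: ifP; [left|right].
rewrite !(@output_prob_box _ _ _ N)// -EFinD lee_fin; apply: le_trans BCn.
have -> : (\sum_(y < N) Num.sqrt (law p T y * law q T y)) ^+ n =
    \prod_(i < n) \sum_(y < N) Num.sqrt (law p T y * law q T y).
  by rewrite prodr_const card_ord.
rewrite -(@product_affinity _ _ _ _ p q (fun=> T))//.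
rewrite [X in X + _ <= _]big_mkcond [X in _ + X <= _]big_mkcond -big_split /=.
apply: ler_sum => w _.
set P := \prod_i law p T _; set Q := \prod_i law q T _.
have P0 : 0 <= P by apply: prodr_ge0 => i _; exact: law_ge0.
have Q0 : 0 <= Q by apply: prodr_ge0 => i _; exact: law_ge0.
have testE : likelihood_test p q T (box_tuple w) = if Q <= P then p else q.
  rewrite /likelihood_test !big_tuple.
  under eq_bigr do rewrite tnth_mktuple.
  by under [X in _ <= X]eq_bigr do rewrite tnth_mktuple.
apply: le_trans (min_le_sqrtM P0 Q0).
case: leP testE => _ testE.
  by rewrite memNset ?mem_set ?add0r//= testE//.
by rewrite mem_set ?memNset ?addr0//= testE//; exact: nesym.
Qed.

Definition randomized_response {R : realType} {k : nat} (eps : R) (S : {set 'I_k})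
    (y : nat) (x : 'I_k) : R :=
  let d := (1 + expR eps)^-1 in
  match y with
  | 0 => if x \in S then d else 1 - d
  | 1 => if x \in S then 1 - d else d
  | _ => 0
  end.

Lemma flip_prob_bounds (R : realType) (eps : R) : 0 < eps ->
  let d := (1 + expR eps)^-1 in [/\ 0 < d, d < 1 - d & 1 - d = expR eps * d].
Proof.
move=> eps0 d; have e1 : 1 < expR eps by rewrite expR_gt1.
have d0 : 0 < d by rewrite invr_gt0; lra.
have dE : 1 - d = expR eps * d by rewrite /d; field; lra.
by split => //; rewrite dE ltr_pMl.
Qed.

Lemma randomized_response_channel (R : realType) (k : nat) (eps : R) (S : {set 'I_k}) :
  0 < eps -> channel (randomized_response eps S) /\ LDP eps (randomized_response eps S).
Proof.
move=> /flip_prob_bounds/=; rewrite /LDP /channel /randomized_response.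
move: (_^-1) => d [d0 d1 dE].
have e0 : 0 < expR eps by exact: expR_gt0.
have e1 : 1 < expR eps by nra.
split; [split|].
- by move=> x [|[|y]]//; case: ifP; lra.
- move=> x; set f := fun y : nat => _.
  rewrite (_ : (\esum_(y in _) _)%E = \esum_(y in `I_2) f y).
    rewrite esum_fset// => [|i _].
      rewrite -fsbig_ord big_ord_recl big_ord1 /f /=.
      by rewrite -EFinD; case: ifP => _; congr EFin; ring.
    by rewrite /f lee_fin; case: i => [|[|i]]//; case: ifP; lra.
  rewrite [RHS]esum_mkcond; apply: eq_esum => y _.
  by case: y => [|[|y]]; rewrite ?mem_setE /f//= asboolF.
- move=> x x' [|[|y]]; last by rewrite mulr0.
    by case: ifP; case: ifP; nra.
  by case: ifP; case: ifP; nra.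
Qed.

Lemma law_randomized_response (R : realType) (k : nat) (eps : R) (S : {set 'I_k})
    (p : {ffun 'I_k -> R}) : \sum_x p x = 1 ->
  let d := (1 + expR eps)^-1 in
  law p (randomized_response eps S) 1 = d + (1 - 2 * d) * \sum_(x in S) p x.
Proof.
move=> p1 d; rewrite /law [X in _ = X + _](_ : d = \sum_x p x * d); last first.
  by rewrite -mulr_suml p1 mul1r.
rewrite [\sum_(x in S) _]big_mkcond mulr_sumr -big_split.
by apply: eq_bigr => x _ /=; rewrite -/d; case: ifP => _; ring.
Qed.

(** Only the share [h] of output 1 in the squared Hellinger distance is used. The hypothesis gives X
    h >= 18, so the affinity to the power n is at most e^(-9) <= 1/10. *)
Lemma nstar_le_of_set (R : realType) (k : nat) (p q : {ffun 'I_k -> R})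
    (eps X : R) (S : {set 'I_k}) :
  simplex p -> simplex q -> p <> q -> 0 < eps -> 1 <= X ->
  let d := (1 + expR eps)^-1 in
  36 * (2 * d + \sum_(x in S) p x + \sum_(x in S) q x) <=
    X * ((1 - 2 * d) * (\sum_(x in S) p x - \sum_(x in S) q x)) ^+ 2 ->
  (nstar p q eps <= (2 * X)%:E)%E.
Proof.
move=> [p0 p1] [q0 q1] pq eps0 X1 d HX.
have [d0 d1 dE] := flip_prob_bounds eps0; rewrite -/d in d0 d1 dE.
have [chT LT] := randomized_response_channel S eps0.
set T := randomized_response eps S in chT LT.
have [T0 _] := chT.
(* The number of users lies in (X, 2 X] since X >= 1. *)
set n := (Num.truncn X).+1.
have X0 : 0 <= X by lra.
have /andP[nX Xn] := truncn_itv X0.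
have Xn' : X <= n%:R by exact: ltW.
have nX' : n%:R <= 2 * X by rewrite /n -natr1; lra.
pose a := \sum_(x in S) p x; pose b := \sum_(x in S) q x.
have a0 : 0 <= a by exact: sumr_ge0.
have b0 : 0 <= b by exact: sumr_ge0.
have P1E : law p T 1 = d + (1 - 2 * d) * a by rewrite law_randomized_response.
have Q1E : law q T 1 = d + (1 - 2 * d) * b by rewrite law_randomized_response.
have lp y : 0 <= law p T y by exact: law_ge0.
have lq y : 0 <= law q T y by exact: law_ge0.
pose h := (Num.sqrt (law p T 1) - Num.sqrt (law q T 1)) ^+ 2.
have h0 : 0 <= h by exact: sqr_ge0.
have nh : 9 <= h / 2 * n%:R.
  have [+ _] := sqrt_diff_sqr_bounds (lp 1%N) (lq 1%N); rewrite -/h P1E Q1E => H.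
  have s0 : 0 < 2 * d + a + b by lra.
  rewrite -(ler_pM2l s0).
  have H' : ((1 - 2 * d) * (a - b)) ^+ 2 <= 2 * (2 * d + a + b) * h.
    apply: le_trans (_ : 2 * (d + (1 - 2 * d) * a + (d + (1 - 2 * d) * b)) * h <= _).
      by move: H; apply: le_trans; rewrite le_eqVlt; apply/orP; left; apply/eqP; ring.
    by rewrite ler_wpM2r//; nra.
  have := ler_wpM2l X0 H'.
  have : X * (2 * (2 * d + a + b) * h) <= n%:R * (2 * (2 * d + a + b) * h).
    by rewrite ler_wpM2r// mulr_ge0//; lra.
  move: HX; rewrite -/a -/b; lra.
have n0 : (0 < n)%N by [].
have TN y x : (2 <= y)%N -> T y x = 0 by case: y => [|[|y]].
have mass (r : {ffun 'I_k -> R}) : \sum_x r x = 1 -> \sum_(y < 2) law r T y = 1.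
  move=> r1; rewrite law_sum -[RHS]r1; apply: eq_bigr => x _.
  rewrite big_ord_recl big_ord1 /T /randomized_response /= -/d.
  by case: ifP => _; ring.
apply: le_trans (_ : (n%:R)%:E <= _)%E; last by rewrite lee_fin.
apply: ereal_inf_lbound; exists (TestRule (likelihood_test p q T) (fun _ : 'I_n => T)) => //.
apply: (@solves_likelihood_test _ _ n 2) => //.
set BC := \sum_(y < 2) _.
have BC0 : 0 <= BC by apply: sumr_ge0 => y _; exact: sqrtr_ge0.
have BCh : BC <= 1 - h / 2.
  have : h <= \sum_(y < 2) (Num.sqrt (law p T y) - Num.sqrt (law q T y)) ^+ 2.
    by rewrite big_ord_recl big_ord1 lerDr sqr_ge0.
  under eq_bigr do rewrite sqrt_diff_sqr//.
  by rewrite sumrB big_split /= -mulr_sumr !mass// -/BC; lra.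
apply: (@le_trans _ _ (expR (- (h / 2)) ^+ n)).
  rewrite lerXn2r ?nnegrE ?expR_ge0//; apply: le_trans BCh _; exact: expR_ge1Dx.
rewrite -expRM_natr mulNr expRN lef_pV2 ?posrE ?expR_gt0//.
(* The bound 1 + x <= e^x with x >= 9 gives exactly the needed 10. *)
by have := expR_ge1Dx (h / 2 * n%:R); lra.
Qed.

(** * Sets that retain the total variation or the Hellinger distance *)

(** As [p - q] sums to 0, its positive and negative parts have equal totals, each half of the L1
    distance. *)
Lemma scheffe_set (R : realType) (k : nat) (p q : {ffun 'I_k -> R}) :
  simplex p -> simplex q ->
  exists S : {set 'I_k}, \sum_(x in S) p x - \sum_(x in S) q x = dTV p q.
Proof.
move=> [_ p1] [_ q1]; exists [set x | q x <= p x]%SET.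
have : \sum_x (p x - q x) = 0 by rewrite sumrB p1 q1 subrr.
rewrite /dTV (bigID (fun x => x \in [set x | q x <= p x]%SET)) /=.
rewrite [\sum_i `|_|](bigID (fun x => x \in [set x | q x <= p x]%SET)) /=.
rewrite -sumrB.
under [X in 2^-1 * (X + _)]eq_bigr => x xS.
  rewrite ger0_norm; last by rewrite subr_ge0; rewrite inE in xS.
  over.
under [X in 2^-1 * (_ + X)]eq_bigr => x xS.
  rewrite ltr0_norm; last by rewrite subr_lt0 ltNge; rewrite inE in xS.
  over.
rewrite sumrN; lra.
Qed.

Lemma sqrt_diff_sqr_le (R : rcfType) (x y c : R) : 0 <= x -> 0 <= y ->
  `|x - y| <= c * (x + y) -> (Num.sqrt x - Num.sqrt y) ^+ 2 <= c ^+ 2 * (x + y).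
Proof.
move=> x0 y0 xyc; have [_ H] := sqrt_diff_sqr_bounds x0 y0.
have [s0|s0] := ltP 0 (x + y).
  rewrite -(ler_pM2l s0); apply: le_trans H _.
  rewrite [leRHS](_ : _ = (c * (x + y)) ^+ 2); last by ring.
  by rewrite -real_normK ?num_real// lerXn2r ?nnegrE//; apply: le_trans xyc.
have -> : x = 0 by lra.
have -> : y = 0 by lra.
by rewrite !subrr expr0n addr0 mulr0.
Qed.

(** With w = p(S) + q(S), the lower edge of the band gives (c w)^2 <= r w, hence c^2 w <= r, and the
    upper edge bounds the Hellinger share by (2 c)^2 w. *)
Lemma band_hellinger_le (R : realType) (k : nat) (p q : {ffun 'I_k -> R})
    (S : {set 'I_k}) (c r : R) :
  (forall x, 0 <= p x) -> (forall x, 0 <= q x) -> 0 <= c -> 0 <= r ->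
  (forall x, x \in S -> c * (p x + q x) <= p x - q x <= 2 * c * (p x + q x)) ->
  (\sum_(x in S) p x - \sum_(x in S) q x) ^+ 2 <=
    r * (\sum_(x in S) p x + \sum_(x in S) q x) ->
  \sum_(x in S) (Num.sqrt (p x) - Num.sqrt (q x)) ^+ 2 <= 4 * r.
Proof.
move=> p0 q0 c0 r0 pqS; set w := \sum_(x in S) p x + \sum_(x in S) q x => Hr.
have w0 : 0 <= w by apply: addr_ge0; exact: sumr_ge0.
have cw : c * w <= \sum_(x in S) p x - \sum_(x in S) q x.
  rewrite /w -big_split mulr_sumr -sumrB.
  by apply: ler_sum => x /pqS /andP[].
apply: (@le_trans _ _ ((2 * c) ^+ 2 * w)).
  rewrite /w -big_split mulr_sumr; apply: ler_sum => x /pqS /andP[h1 h2].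
  apply: sqrt_diff_sqr_le => //; rewrite ger0_norm//.
  by apply: le_trans h1; rewrite mulr_ge0// addr_ge0.
move: w0; rewrite le_eqVlt => /predU1P[<-|w0]; first by rewrite mulr0 mulr_ge0.
have cw0 : 0 <= c * w by rewrite mulr_ge0// ltW.
have : (c * w) ^+ 2 <= r * w.
  by apply: le_trans Hr; rewrite lerXn2r ?nnegrE//; apply: le_trans cw.
by move=> H; rewrite -(ler_pM2r w0); lra.
Qed.

Lemma dyadic_level (R : realType) (t w : R) (J : nat) : 0 <= w -> t <= w ->
  t <= 2^-1 ^+ J * w \/
  exists j : 'I_J, 2^-1 ^+ j.+1 * w <= t <= 2 * 2^-1 ^+ j.+1 * w.
Proof.
move=> w0 tw; elim: J => [|J [IH|[j IH]]].
- by left; rewrite expr0 mul1r.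
- have [h|h] := leP t (2^-1 ^+ J.+1 * w); [by left|right].
  by exists ord_max; rewrite (ltW h) /= exprS mulrA mulfV ?mul1r.
- by right; exists (lift ord_max j); rewrite lift_max.
Qed.

(** Points with |p - q| <= 2^(-J) (p + q) contribute at most 2 * 4^(-J) in total. The others fall
    into J bands for each sign of p - q, and each band contributes at most 4 r. *)
Lemma hellinger_le_bands (R : realType) (k J : nat) (p q : {ffun 'I_k -> R}) (r : R) :
  simplex p -> simplex q -> 0 <= r ->
  (forall S : {set 'I_k}, (\sum_(x in S) p x - \sum_(x in S) q x) ^+ 2 <=
    r * (\sum_(x in S) p x + \sum_(x in S) q x)) ->
  dhel2 p q <= 2 * (2^-1 ^+ J) ^+ 2 + 8 * J%:R * r.
Proof.
move=> [p0 p1] [q0 q1] r0 Hr.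
pose D x := (Num.sqrt (p x) - Num.sqrt (q x)) ^+ 2.
have D0 x : 0 <= D x by exact: sqr_ge0.
pose c (j : 'I_J) : R := 2^-1 ^+ j.+1.
have c0 j : 0 <= c j by rewrite exprn_ge0// invr_ge0.
pose Sp (j : 'I_J) :=
  [set x | c j * (p x + q x) <= p x - q x <= 2 * c j * (p x + q x)]%SET.
pose Sm (j : 'I_J) :=
  [set x | c j * (q x + p x) <= q x - p x <= 2 * c j * (q x + p x)]%SET.
have Dle x : D x <= (2^-1 ^+ J) ^+ 2 * (p x + q x) +
    \sum_(j < J) ((if x \in Sp j then D x else 0) + (if x \in Sm j then D x else 0)).
  have w0 : 0 <= p x + q x by rewrite addr_ge0.
  have t0 (P : pred 'I_J) : 0 <= \sum_(j < J | P j)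
      ((if x \in Sp j then D x else 0) + (if x \in Sm j then D x else 0)).
    by apply: sumr_ge0 => j _; apply: addr_ge0; case: ifP.
  have tw : `|p x - q x| <= p x + q x.
    by rewrite ler_norml; move: (p0 x) (q0 x); lra.
  have [h|[j hj]] := dyadic_level J w0 tw.
    by apply: le_trans (sqrt_diff_sqr_le (p0 x) (q0 x) h) _; rewrite lerDl.
  rewrite (bigD1 j)//= addrA; apply: ler_wpDr; first exact: t0.
  apply: ler_wpDl; first by rewrite mulr_ge0 ?sqr_ge0.
  have [pq|/ltW pq] := leP (q x) (p x).
    rewrite ifT ?lerDl; first by case: ifP.
    by rewrite inE; move: hj; rewrite ger0_norm// subr_ge0.
  rewrite [X in _ + X]ifT ?lerDr; first by case: ifP.
  by rewrite inE; move: hj; rewrite distrC ger0_norm ?subr_ge0// [p x + q x]addrC.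
apply: (le_trans (ler_sum _ (fun x _ => Dle x))).
rewrite big_split /= -mulr_sumr big_split /= p1 q1 exchange_big /=.
rewrite lerD// ?[2 * _]mulrC//.
apply: (@le_trans _ _ (\sum_(j < J) (8 * r))); last first.
  by rewrite sumr_const card_ord -[leLHS]mulr_natr mulrAC.
apply: ler_sum => j _; rewrite big_split /= -!big_mkcond /=.
have h1 : \sum_(x in Sp j) D x <= 4 * r.
  by apply: (band_hellinger_le p0 q0 (c0 j)) => // x; rewrite inE.
have h2 : \sum_(x in Sm j) D x <= 4 * r.
  rewrite /D; under eq_bigr do rewrite -sqrrN opprB.
  apply: (band_hellinger_le q0 p0 (c0 j)) => //; first by move=> x; rewrite inE.
  by rewrite -sqrrN opprB [X in r * X]addrC.
lra.
Qed.

Lemma ln2_ge (R : realType) : 2^-1 <= ln (2 : R).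
Proof.
have := @le_ln1Dx R (- 2^-1); rewrite (_ : 1 + - 2^-1 = 2^-1); last by field.
rewrite lnV ?posrE//; lra.
Qed.

Lemma expR1_le4 (R : realType) : expR 1 <= 4 :> R.
Proof.
rewrite -[leRHS]lnK ?posrE// ler_expR (_ : 4 = 2 * 2 :> R); last by ring.
by rewrite lnM ?posrE//; have := ln2_ge R; lra.
Qed.

Lemma ln_inv_ge (R : realType) (x : R) : 0 < x < 2^-1 -> ln 2 <= ln x^-1.
Proof.
move=> /andP[x0 x2]; rewrite ler_ln ?posrE ?invr_gt0//.
by rewrite -[leLHS]invrK lef_pV2 ?posrE// ?invr_gt0// ltW.
Qed.

Lemma hellinger_set (R : realType) (k : nat) (p q : {ffun 'I_k -> R}) (nu rho : R) :
  0 < rho < 2^-1 -> 0 < nu < 2^-1 -> Sclass rho nu p q ->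
  let r := rho / (64 * (ln nu^-1 + ln rho^-1)) in
  exists S : {set 'I_k}, 0 < (\sum_(x in S) p x - \sum_(x in S) q x) ^+ 2 /\
    r * (\sum_(x in S) p x + \sum_(x in S) q x) <=
    (\sum_(x in S) p x - \sum_(x in S) q x) ^+ 2.
Proof.
move=> hrho hnu [sp sq _ hel] r.
have := ln_inv_ge hnu; have := ln_inv_ge hrho; have := ln2_ge R.
set lr := ln rho^-1 in r *; set ln_ := ln nu^-1 in r * => l2 lr2 ln2.
have rho0 : 0 < rho by lra.
have L0 : 0 < ln_ + lr by lra.
have r0 : 0 <= r by apply: divr_ge0; lra.
(* If every set failed, the band bound would give rho <= rho / 4 + rho / 2. *)
apply: contrapT => /forallNP nS.
have Hr (S : {set 'I_k}) : (\sum_(x in S) p x - \sum_(x in S) q x) ^+ 2 <=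
    r * (\sum_(x in S) p x + \sum_(x in S) q x).
  have w0 : 0 <= \sum_(x in S) p x + \sum_(x in S) q x.
    by case: sp sq => p0 _ [q0 _]; apply: addr_ge0; exact: sumr_ge0.
  rewrite leNgt; apply/negP => h; apply: (nS S); split; last exact: ltW.
  by apply: le_lt_trans h; rewrite mulr_ge0.
(* J exceeds ln (8 / rho), so 4^J >= e^J >= 8 / rho, and it is still at most 4 times the sum of the
   logarithms. *)
pose J := (Num.truncn (3 * ln 2 + lr)).+1.
have l0 : 0 <= 3 * ln 2 + lr by lra.
have /andP[Jle Jgt] := truncn_itv l0.
have J4 : J%:R <= 4 * (ln_ + lr) by rewrite /J -[X in X <= _]natr1; lra.
have eJ : (2^-1 ^+ J) ^+ 2 <= rho / 8.
  have -> : (2^-1 ^+ J) ^+ 2 = (4 ^+ J)^-1 :> R.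
    by rewrite -exprM mulnC exprM -exprVn; congr (_ ^+ J); field.
  rewrite -[leRHS]invrK lef_pV2 ?posrE ?exprn_gt0 ?invr_gt0 ?divr_gt0//.
  apply: (@le_trans _ _ (expR 1 ^+ J)); last first.
    by rewrite lerXn2r ?nnegrE ?expR_ge0//; have := expR1_le4 R; lra.
  rewrite -expRM_natr mul1r -[leLHS]lnK ?posrE ?invr_gt0 ?divr_gt0// ler_expR.
  rewrite invf_div ln_div ?posrE// -[- ln rho]lnV ?posrE// -/lr.
  have -> : ln 8 = 3 * ln 2 :> R.
    have -> : 8 = 2 ^+ 3 :> R by ring.
    by rewrite lnXn// mulr_natl.
  exact: ltW.
clear Jle Jgt; clearbody J.
have := @hellinger_le_bands _ _ J _ _ _ sp sq r0 Hr; rewrite hel.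
have rE : 8 * (4 * (ln_ + lr)) * r = rho / 2 by rewrite /r; field; lra.
have : 8 * J%:R * r <= 8 * (4 * (ln_ + lr)) * r.
  by apply: ler_wpM2r => //; apply: ler_wpM2l.
rewrite rE; lra.
Qed.

(** * Minimax bounds *)

Lemma Sclass_neq (R : realType) (k : nat) (p q : {ffun 'I_k -> R}) (nu rho : R) :
  0 < nu -> Sclass rho nu p q -> p <> q.
Proof.
move=> nu0 [_ _ tv _] pq; move: tv; rewrite pq /dTV big1; first by rewrite mulr0; lra.
by move=> x _; rewrite subrr normr0.
Qed.

(** Here [g] bounds from below the contrast 1 - 2 d kept by randomized response, and 144 covers 36
    (2 d + p(S) + q(S)), as all three terms are at most 1. *)
Lemma nstar_minimax_le_TV (R : realType) (rho nu eps g X : R) :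
  0 < nu -> 0 < eps -> 1 <= X -> 0 <= g -> g <= 1 - 2 * (1 + expR eps)^-1 ->
  144 <= X * (g * nu) ^+ 2 ->
  (nstar_minimax rho nu eps <= (2 * X)%:E)%E.
Proof.
move=> nu0 eps0 X1 g0 gd HX; apply: ge_ereal_sup => _ [k [p [q [Spq ->]]]].
have pq := Sclass_neq nu0 Spq; have [sp sq tv _] := Spq.
have [S SE] := scheffe_set sp sq.
apply: (@nstar_le_of_set _ _ p q eps X S) => //; rewrite SE tv.
have [d0 d1 _] := flip_prob_bounds eps0; move: d0 d1 gd; set d := _^-1 => d0 d1 gd.
have le1 (r : {ffun 'I_k -> R}) : simplex r -> \sum_(x in S) r x <= 1.
  move=> [r0 <-]; rewrite [leRHS](bigID (fun x => x \in S)) /= lerDl.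
  exact: sumr_ge0.
apply: (@le_trans _ _ 144); first by move: (le1 p sp) (le1 q sq); lra.
apply: le_trans HX _; rewrite ler_wpM2l; [by []|lra|].
rewrite lerXn2r ?nnegrE ?mulr_ge0//; [lra|lra|lra|].
by rewrite ler_wpM2r//; lra.
Qed.

Lemma nstar_minimax_le_hellinger (R : realType) (rho nu eps X : R) :
  0 < rho < 2^-1 -> 0 < nu < 2^-1 -> 0 < eps -> 2 <= expR eps -> 1 <= X ->
  let r := rho / (64 * (ln nu^-1 + ln rho^-1)) in
  1296 <= X * r ^+ 2 * expR eps -> 648 <= X * r ->
  (nstar_minimax rho nu eps <= (2 * X)%:E)%E.
Proof.
move=> hrho hnu eps0 e2 X1 r HX1 HX2; apply: ge_ereal_sup => _ [k [p [q [Spq ->]]]].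
have nu0 : 0 < nu by lra.
have pq := Sclass_neq nu0 Spq; have [sp sq _ _] := Spq.
have e0 := expR_gt0 eps.
have L0 : 0 < ln nu^-1 + ln rho^-1.
  by have := ln_inv_ge hnu; have := ln_inv_ge hrho; have := ln2_ge R; lra.
have r0 : 0 < r by apply: divr_gt0; lra.
have [S [D0 Dr]] := hellinger_set hrho hnu Spq; rewrite -/r in Dr.
apply: (@nstar_le_of_set _ _ p q eps X S) => //.
have [d0 d1 dE] := flip_prob_bounds eps0.
have dlt : (1 + expR eps)^-1 <= 3^-1.
  by rewrite lef_pV2 ?posrE//; lra.
move: d0 d1 dE dlt; set d := _^-1 => d0 d1 dE dlt.
have a0 : 0 <= \sum_(x in S) p x by case: sp => p0 _; exact: sumr_ge0.
have b0 : 0 <= \sum_(x in S) q x by case: sq => q0 _; exact: sumr_ge0.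
move: a0 b0 D0 Dr; set a := \sum_(x in S) p x; set b := \sum_(x in S) q x.
clearbody a b => a0 b0 D0 Dr.
have X0 : 0 <= X by lra.
(* From r |a - b| <= r (a + b) <= (a - b)^2, division by |a - b| > 0 gives r <= |a - b|. *)
have rD : r ^+ 2 <= (a - b) ^+ 2.
  have ab : `|a - b| <= a + b by rewrite ler_norml; lra.
  have n0 : 0 < `|a - b| by rewrite normr_gt0; apply: contraTneq D0 => ->; rewrite expr0n ltxx.
  have nE : `|a - b| ^+ 2 = (a - b) ^+ 2 by rewrite real_normK ?num_real.
  rewrite -nE lerXn2r ?nnegrE ?normr_ge0 ?(ltW r0)// -(ler_pM2r n0) -expr2 nE.
  by apply: le_trans Dr; rewrite ler_wpM2l// ltW.
(* Since (1 - 2 d)^2 >= 1/9, the terms 72 d and 36 (a + b) may each take 1/18 of X (a - b)^2, whence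
   1296 and 648. The factor e^eps is absorbed by [expR eps * d = 1 - d <= 1]. *)
have H1 : 1296 * d <= X * (a - b) ^+ 2.
  have : 1296 * d <= X * r ^+ 2.
    have := ler_wpM2r (ltW d0) HX1.
    rewrite -[X in _ <= X]mulrA -dE => h; apply: le_trans h _.
    by apply: ler_piMr; [rewrite mulr_ge0// sqr_ge0|lra].
  by move=> h; apply: le_trans h _; rewrite ler_wpM2l.
have H2 : 648 * (a + b) <= X * (a - b) ^+ 2.
  apply: (@le_trans _ _ (X * r * (a + b))).
    by rewrite ler_wpM2r// addr_ge0.
  by rewrite -mulrA ler_wpM2l.
have g9 : 9^-1 <= (1 - 2 * d) ^+ 2.
  have -> : 9^-1 = 3^-1 ^+ 2 :> R by field.
  by rewrite lerXn2r ?nnegrE//; lra.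
have Y0 : 0 <= X * (a - b) ^+ 2 by rewrite mulr_ge0// sqr_ge0.
rewrite exprMn mulrCA; have := ler_wpM2r Y0 g9; lra.
Qed.

Lemma log_sum_ge1 (R : realType) (rho nu : R) :
  0 < rho < 2^-1 -> 0 < nu < 2^-1 -> 1 <= ln nu^-1 + ln rho^-1.
Proof.
by move=> /ln_inv_ge hrho /ln_inv_ge hnu; have := ln2_ge R; lra.
Qed.

(** The constant 6 * 10^6 exceeds 1296 * 64^2, the most demanding of the three requirements. *)
Lemma hellinger_budget (R : realFieldType) (L rho e w : R) :
  1 <= L -> 0 < rho < 1 -> 0 < w -> w <= rho -> w <= e * rho ^+ 2 ->
  let X := 6 * 10 ^+ 6 * L ^+ 2 / w in let r := rho / (64 * L) in
  [/\ 1 <= X, 1296 <= X * r ^+ 2 * e & 648 <= X * r].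
Proof.
move=> L1 /andP[rho0 rho1] w0 wr we X r.
have L2 : L <= L ^+ 2 by rewrite expr2 ler_peMr//; lra.
split.
- by rewrite ler_pdivlMr//; lra.
- have -> : X * r ^+ 2 * e = 6 * 10 ^+ 6 / 64 ^+ 2 * (e * rho ^+ 2 / w).
    by rewrite /X /r; field; rewrite !lt0r_neq0//; lra.
  have : 1 <= e * rho ^+ 2 / w by rewrite ler_pdivlMr// mul1r.
  by clear; lra.
- have -> : X * r = 6 * 10 ^+ 6 / 64 * (L * (rho / w)).
    by rewrite /X /r; field; rewrite !lt0r_neq0//; lra.
  have : 1 * 1 <= L * (rho / w).
    by apply: ler_pM => //; rewrite ler_pdivlMr// mul1r.
  by clear; lra.
Qed.

(** Serves both regimes with e^eps >= e: [w] is e^eps rho^2 up to e^eps = 1/rho, and rho beyond. *)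
Lemma nstar_minimax_le_ratio (R : realType) (rho nu eps w : R) :
  0 < rho < 2^-1 -> 0 < nu < 2^-1 -> 0 < eps -> 2 <= expR eps ->
  0 < w -> w <= rho -> w <= expR eps * rho ^+ 2 ->
  (nstar_minimax rho nu eps <=
     (12 * 10 ^+ 6 * (ln nu^-1 + ln rho^-1) ^+ 2 * (1 / w))%:E)%E.
Proof.
move=> hrho hnu eps0 e2 w0 wr we; set L := ln _ + _.
have L1 : 1 <= L by exact: log_sum_ge1.
have rho01 : 0 < rho < 1 by lra.
have [X1 X2 X3] := hellinger_budget L1 rho01 w0 wr we.
have -> : 12 * 10 ^+ 6 * L ^+ 2 * (1 / w) = 2 * (6 * 10 ^+ 6 * L ^+ 2 / w).
  by rewrite mul1r !mulrA; congr (_ / _); clear; ring.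
exact: nstar_minimax_le_hellinger.
Qed.

Lemma nstar_minimax_ge (R : realType) (rho nu eps B y : R) :
  0 < rho < 2^-1 -> 0 < nu < 2^-1 -> 2 * nu ^+ 2 <= rho <= nu ->
  0 <= y -> y * B <= 1000 ->
  (forall T, channel T -> LDP eps T -> forall N,
     \sum_(z < N) (Num.sqrt (law (hard_fst nu (hard_mass rho nu)) T z) -
       Num.sqrt (law (hard_snd nu (hard_mass rho nu)) T z)) ^+ 2 <= B) ->
  ((y / 2000)%:E <= nstar_minimax rho nu eps)%E.
Proof.
move=> hrho hnu hrn y0 yB HB.
have Spq := hard_pair_class hrho hnu hrn.
have nu0 : 0 < nu by lra.
have pq := Sclass_neq nu0 Spq.
set p := hard_fst _ _ in Spq pq HB; set q := hard_snd _ _ in Spq pq HB.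
apply: (@le_trans _ _ (nstar p q eps)); last first.
  by apply: ereal_sup_ubound; exists 4%N, p, q.
have [sp sq _ _] := Spq.
apply: le_ereal_inf_tmp => _ [t st <-]; rewrite lee_fin.
have := solves_users_ge sp sq pq st HB; have u0 := ler0n R (users t).
move: ((users t)%:R : R) u0 => u u0 uB.
have := ler_wpM2l u0 yB; have := ler_wpM2l y0 uB; lra.
Qed.

Lemma LDP_diff_le (R : realType) (k : nat) (eps : R) (T : nat -> 'I_k -> R) :
  0 <= eps -> channel T -> LDP eps T -> forall y x x',
  (T y x - T y x') ^+ 2 <= (expR eps - 1) ^+ 2 * (T y x + T y x') ^+ 2.
Proof.
move=> eps0 [T0 _] LT y x x'; rewrite -exprMn -[leLHS]real_normK ?num_real//.
have e1 : 1 <= expR eps by have := expR_ge1Dx eps; lra.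
move: (T0 x y) (T0 x' y) (LT x x' y) (LT x' x y) => h h' l l'.
have m0 : 0 <= expR eps - 1 by lra.
have K0 : 0 <= (expR eps - 1) * (T y x + T y x') by rewrite mulr_ge0// addr_ge0.
rewrite lerXn2r ?nnegrE ?normr_ge0//.
by rewrite ler_norml; nra.
Qed.

Lemma hard_pair_small_eps (R : realType) (rho nu eps : R) :
  0 < rho < 2^-1 -> 0 < nu < 2^-1 -> 2 * nu ^+ 2 <= rho <= nu ->
  0 < eps <= 1 -> forall T, channel T -> LDP eps T -> forall N,
  \sum_(z < N) (Num.sqrt (law (hard_fst nu (hard_mass rho nu)) T z) -
       Num.sqrt (law (hard_snd nu (hard_mass rho nu)) T z)) ^+ 2 <=
  640 * (eps ^+ 2 * nu ^+ 2).
Proof.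
move=> hrho hnu hrn /andP[eps0 eps1] T chT LT N.
have [al0 aln _ _] := hard_mass_bounds hrho hnu hrn.
have al_nu : 0 <= hard_mass rho nu <= nu by rewrite al0.
have TM := LDP_diff_le (ltW eps0) chT LT.
apply: le_trans (hard_pair_hellinger N hnu al_nu (sqr_ge0 _) chT LT TM) _.
have e4 : expR eps <= 4 by apply: le_trans (expR1_le4 R); rewrite ler_expR.
have e1 : 1 < expR eps by rewrite expR_gt1.
(* Multiplying 1 - eps <= e^(-eps) by e^eps gives e^eps - 1 <= eps e^eps. The constant 640 is then 8
   * 16 * 5. *)
have m4 : expR eps - 1 <= 4 * eps.
  have := expR_ge1Dx (- eps); rewrite expRN => h.
  have := ler_wpM2l (expR_ge0 eps) h; rewrite mulfV ?lt0r_neq0 ?expR_gt0//.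
  by nra.
have m2 : (expR eps - 1) ^+ 2 <= 16 * eps ^+ 2 by nra.
have a2 : hard_mass rho nu ^+ 2 <= nu ^+ 2.
  by rewrite lerXn2r ?nnegrE//; lra.
have K5 : hard_mass rho nu ^+ 2 * expR eps + nu ^+ 2 <= 5 * nu ^+ 2.
  by have := ler_pM (sqr_ge0 _) (expR_ge0 eps) a2 e4; lra.
have K0 : 0 <= hard_mass rho nu ^+ 2 * expR eps + nu ^+ 2.
  apply: addr_ge0; last exact: sqr_ge0.
  by apply: mulr_ge0; [exact: sqr_ge0|exact: expR_ge0].
by have := ler_pM (sqr_ge0 _) K0 m2 K5; lra.
Qed.

Lemma hard_pair_large_eps (R : realType) (rho nu eps : R) :
  0 < rho < 2^-1 -> 0 < nu < 2^-1 -> 2 * nu ^+ 2 <= rho <= nu ->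
  forall T, channel T -> LDP eps T -> forall N,
  \sum_(z < N) (Num.sqrt (law (hard_fst nu (hard_mass rho nu)) T z) -
       Num.sqrt (law (hard_snd nu (hard_mass rho nu)) T z)) ^+ 2 <=
  8 * (expR eps * rho ^+ 2 + nu ^+ 2).
Proof.
move=> hrho hnu hrn T chT LT N.
have [al0 aln alr _] := hard_mass_bounds hrho hnu hrn.
have al_nu : 0 <= hard_mass rho nu <= nu by rewrite al0.
have TM y x x' : (T y x - T y x') ^+ 2 <= 1 * (T y x + T y x') ^+ 2.
  by have [T0 _] := chT; move: (mulr_ge0 (T0 x y) (T0 x' y)); nra.
apply: le_trans (hard_pair_hellinger N hnu al_nu ler01 chT LT TM) _.
rewrite mulr1 ler_wpM2l// lerD2r mulrC ler_wpM2l ?expR_ge0//.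
by rewrite lerXn2r ?nnegrE//; lra.
Qed.

Lemma log_factor_ge (R : realType) (rho nu z : R) :
  0 < rho < 2^-1 -> 0 < nu < 2^-1 -> z <= 10 ^+ 4 ->
  z <= 12 * 10 ^+ 6 * (ln nu^-1 + ln rho^-1) ^+ 2.
Proof.
move=> hrho hnu hz; have := exprn_ege1 2 (log_sum_ge1 hrho hnu).
by move: (_ ^+ 2) => L2; clear -hz; lra.
Qed.

Lemma tilde_Theta_of_bounds (R : realType) (rho nu y : R) (x : \bar R) :
  0 < rho < 2^-1 -> 0 < nu < 2^-1 -> 0 <= y ->
  ((y / 2000)%:E <= x)%E ->
  (x <= (12 * 10 ^+ 6 * (ln nu^-1 + ln rho^-1) ^+ 2 * y)%:E)%E ->
  tilde_Theta (12 * 10 ^+ 6) 2 rho nu x y.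
Proof.
move=> hrho hnu y0 h1 h2; apply/andP; split => //; apply: le_trans h1.
have h20 : 2000 <= 10 ^+ 4 :> R by lra.
have t0 : 0 < 2000 :> R by lra.
have h := log_factor_ge hrho hnu h20.
by rewrite lee_fin ler_wpM2l// lef_pV2 ?posrE//; exact: lt_le_trans h.
Qed.

Unset Implicit Arguments.

Theorem theorem1p10 (R : realType) :
  exists (C : R) (m : nat), 0 < C /\
  forall rho nu eps : R,
    0 < rho < 2^-1 -> 0 < nu < 2^-1 -> 2 * nu ^+ 2 <= rho <= nu -> 0 < eps ->
    [/\ eps <= 1 ->
          tilde_Theta C m rho nu (nstar_minimax rho nu eps)
            (1 / (eps ^+ 2 * nu ^+ 2)),
        expR 1 <= expR eps <= 1 / rho ->
          tilde_Theta C m rho nu (nstar_minimax rho nu eps)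
            (Num.min (1 / nu ^+ 2) (1 / (expR eps * rho ^+ 2)))
      & 1 / rho < expR eps ->
          tilde_Theta C m rho nu (nstar_minimax rho nu eps) (1 / rho)].
Proof.
exists (12 * 10 ^+ 6), 2%N; split; first by lra.
move=> rho nu eps hrho hnu hrn eps0.
have rho0 : 0 < rho by lra.
have nu0 : 0 < nu by lra.
have e0 := expR_gt0 eps.
split.
- move=> eps1.
  have en0 : 0 < eps ^+ 2 * nu ^+ 2 by rewrite mulr_gt0 ?exprn_gt0.
  apply: tilde_Theta_of_bounds => //; first by rewrite divr_ge0// ltW.
    apply: (nstar_minimax_ge hrho hnu hrn _ _ (hard_pair_small_eps hrho hnu hrn _)).
    + by rewrite divr_ge0// ltW.
    + by rewrite mulrCA mul1r mulVf ?mulr1 ?lt0r_neq0//; lra.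
    + by rewrite eps0.
  (* 3600 is 144 * 5^2, for the contrast eps / 5 that follows from e^eps <= 4. *)
  apply: (@le_trans _ _ (2 * (3600 / (eps ^+ 2 * nu ^+ 2)))%:E); last first.
    by rewrite lee_fin mulrA mul1r ler_wpM2r ?invr_ge0 ?(ltW en0)//; apply: log_factor_ge => //; lra.
  apply: (@nstar_minimax_le_TV _ _ _ _ (eps / 5)) => //; [|lra| |].
  + rewrite ler_pdivlMr// mul1r.
    have : eps ^+ 2 * nu ^+ 2 <= 1 * 1.
      by apply: ler_pM; rewrite ?sqr_ge0 ?expr_le1 //; lra.
    lra.
  + have e4 : expR eps <= 4 by apply: le_trans (expR1_le4 R); rewrite ler_expR.
    have eD := expR_ge1Dx eps.
    have -> : 1 - 2 * (1 + expR eps)^-1 = (expR eps - 1) / (1 + expR eps) by field; lra.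
    by apply: ler_pM; rewrite ?invr_ge0 ?lef_pV2 ?posrE; lra.
  + rewrite (_ : _ * _ = 144); first by [].
    by field; lra.
- move=> /andP[e1]; rewrite ler_expR in e1; rewrite ler_pdivlMr// => er.
  have n2 : 0 < nu ^+ 2 by rewrite exprn_gt0.
  have er2 : 0 < expR eps * rho ^+ 2 by rewrite mulr_gt0 ?exprn_gt0.
  have m0 : 0 <= Num.min (1 / nu ^+ 2) (1 / (expR eps * rho ^+ 2)).
    by rewrite le_min !divr_ge0// ltW.
  apply: tilde_Theta_of_bounds => //.
    apply: (nstar_minimax_ge hrho hnu hrn m0 _ (hard_pair_large_eps hrho hnu hrn)).
    set m := Num.min _ _ in m0 *.
    have mn : m * nu ^+ 2 <= 1 by rewrite -ler_pdivlMr// ge_min lexx.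
    have me : m * (expR eps * rho ^+ 2) <= 1.
      by rewrite -ler_pdivlMr// ge_min lexx orbT.
    lra.
  case: (leP (1 / nu ^+ 2)) => _.
    (* 1296 is 144 * 3^2, for the contrast 1/3 that follows from e^eps >= 2. *)
    apply: (@le_trans _ _ (2 * (1296 / nu ^+ 2))%:E); last first.
      by rewrite lee_fin mulrA mul1r ler_wpM2r ?invr_ge0 ?(ltW n2)//; apply: log_factor_ge => //; lra.
    apply: (@nstar_minimax_le_TV _ _ _ _ 3^-1) => //.
    + rewrite ler_pdivlMr// mul1r.
      have : nu ^+ 2 <= 1 by rewrite expr_le1//; lra.
      lra.
    + have : (1 + expR eps)^-1 <= 3^-1.
        by rewrite lef_pV2 ?posrE//; have := expR_ge1Dx eps; lra.
      lra.
    + rewrite (_ : _ * _ = 144); first by [].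
      by field; lra.
  by apply: nstar_minimax_le_ratio => //; [have := expR_ge1Dx eps; lra|nra].
- rewrite ltr_pdivrMr// => er.
  have y0 : 0 <= 1 / rho by rewrite divr_ge0// ltW.
  apply: tilde_Theta_of_bounds => //.
    (* In this regime data processing alone bounds the squared Hellinger distance of one output by
       rho. *)
    apply: (@nstar_minimax_ge _ _ _ _ rho) => //.
      by rewrite mul1r mulVf ?lt0r_neq0//; lra.
    have [sp sq _ hel] := hard_pair_class hrho hnu hrn.
    move=> T chT LT N; rewrite -{3}hel.
    by case: sp sq => p0 _ [q0 _]; exact: hellinger_data_processing.
  by apply: nstar_minimax_le_ratio => //; nra.
Qed.
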